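(* Let $N$ be a natural number and let $\psi\in\Delta^N$ be any (truncated) stopping rule. Then for any $1\le r\le N-1$ the following inequalities hold: $$L_N(\psi)\ \ge\ \sum_{n=1}^{r}\int(1-\psi_1)\cdots(1-\psi_{n-1})\psi_n(nf_\theta^n+l_n)\,d\mu^n+\int(1-\psi_1)\cdots(1-\psi_r)\left((r+1)f_\theta^{r+1}+V_{r+1}^N\right)d\mu^{r+1}$$ $$\ge\ \sum_{n=1}^{r-1}\int(1-\psi_1)\cdots(1-\psi_{n-1})\psi_n(nf_\theta^n+l_n)\,d\mu^n+\int(1-\psi_1)\cdots(1-\psi_{r-1})\left(rf_\theta^{r}+V_{r}^N\right)d\mu^{r},\qquad( * )$$ where $V_N^N\equiv l_N$ and, recursively for $m=N-1,N-2,\dots,1$, $$V_m^N=\min\{l_m,\ f_\theta^m+R_m^N\},\qquad R_m^N=R_m^N(x_1,\dots,x_m)=\int V_{m+1}^N(x_1,\dots,x_{m+1})\,d\mu(x_{m+1}).$$ The lower bound on the last line $( * )$ is attained by $L_N(\psi)$ if and only if for every $m=r,\dots,N-1$ $$I_{\{l_m<f_\theta^m+R_m^N\}}\le\psi_m\le I_{\{l_m\le f_\theta^m+R_m^N\}}\quad\mu^m\text{-almost everywhere on } C_m^\psi.\qquad( ** )$$ In particular, conditions $( ** )$ for $m=1,2,\dots,N-1$ are necessary and sufficient for $\psi=(\psi_1,\dots,\psi_{N-1},1,\dots)$ to be an optimal truncated rule in $\Delta^N$ (i.e. to minimize $L$ over $\Delta^N$). The minimum value of $L(\psi)$ over $\psi\in\Delta^N$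 is equal to $$1+\int V_1^N\,d\mu(x_1)=1+R_0^N .$$
   Context: Setting. Let $k\ge2$ and let $X_1,X_2,\dots$ be a discrete-time stochastic process with values in a measurable space $\mathcal X$, whose distribution $P_\vartheta$ depends on a parameter $\vartheta$. Let $\mu$ be a $\sigma$-finite measure on $\mathcal X$ and $\mu^n=\mu\otimes\cdots\otimes\mu$ ($n$ times). For every parameter value $\vartheta$ and every $n\ge 1$, under $P_\vartheta$ the vector $(X_1,\dots,X_n)$ has density $f_\vartheta^n(x_1,\dots,x_n)$ with respect to $\mu^n$ (in particular $\int f_\vartheta^{n+1}d\mu(x_{n+1})=f_\vartheta^n$ $\mu^n$-a.e.). Parameter values $\theta_1,\dots,\theta_k$ and one more fixed parameter value $\theta$ (not necessarily one of the $\theta_i$) are given. For a function $F_n=F_n(x_1,\dots,x_n)$, $E_\vartheta F_n=E_\vartheta F_n(X_1,\dots,X_n)=\int F_n f^n_\vartheta\,d\mu^n$. A stopping rule is a sequence $\psi=(\psi_1,\psi_2,\dots)$ of measurable functions $\psi_n=\psi_n(x_1,\dots,x_n)$ with values in $[0,1]$. A decision rule is a sequence $\phi=(\phi_1,\phi_2,\dots)$, $\phi_n=(\phi_n^1,\dots,\phi_n^k)$, of measurable functions of $(x_1,\dots,x_n)$ with $\phi_n^i\ge0$ and $\sum_{i=1}^k\phi_n^i=1$. The stopping time $\tau_\psi$ has distribution $P_\vartheta(\tau_\psi=n)=E_\vartheta(1-\psi_1)\cdots(1-\psi_{n-1})\psi_n$, and $P_\vartheta(\tau_\psi<\infty)=\sum_{n\ge1}P_\vartheta(\tau_\psi=n)$.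 $\alpha_{ij}(\psi,\phi)=\sum_{n=1}^\infty E_{\theta_i}(1-\psi_1)\cdots(1-\psi_{n-1})\psi_n\phi_n^j$. $N(\psi)=\sum_{n=1}^\infty nP_\theta(\tau_\psi=n)$ if $P_\theta(\tau_\psi<\infty)=1$, and $N(\psi)=\infty$ otherwise. Constants $\lambda_{ij}\ge0$ ($1\le i,j\le k$, $i\ne j$) are fixed. $L(\psi,\phi)=N(\psi)+\sum_{i\ne j}\lambda_{ij}\alpha_{ij}(\psi,\phi)$ and $l_n=\min_{1\le j\le k}\sum_{i\ne j}\lambda_{ij}f^n_{\theta_i}$. $L(\psi)=\inf_\phi L(\psi,\phi)$ (infimum over all decision rules), which equals $\sum_{n=1}^\infty\int(1-\psi_1)\cdots(1-\psi_{n-1})\psi_n(nf_\theta^n+l_n)\,d\mu^n$ if $P_\theta(\tau_\psi<\infty)=1$ and $\infty$ otherwise. $\Delta^N$ is the class of truncated stopping rules $\psi=(\psi_1,\dots,\psi_{N-1},1,\dots)$, i.e. with $\psi_N\equiv1$. For $\psi\in\Delta^N$, $L_N(\psi)=\sum_{n=1}^{N}\int(1-\psi_1)\cdots(1-\psi_{n-1})\psi_n(nf_\theta^n+l_n)\,d\mu^n$ (which equals $L(\psi)$). $C_n^\psi=\{(x_1,\dots,x_n):(1-\psi_1(x_1))\cdots(1-\psi_{n-1}(x_1,\dots,x_{n-1}))>0\}$ (with the empty product equal to $1$ for $n=1$). $I_A$ is the indicator function of $A$. $R_0^N=\int V_1^N(x_1)\,d\mu(x_1)$. *)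

(* Defs.v *)
From HB Require Import structures.
From mathcomp Require Import all_boot all_order all_algebra.
From mathcomp Require Import all_classical all_reals all_analysis.

Set Implicit Arguments.
Unset Strict Implicit.
Unset Printing Implicit Defensive.
Import Order.TTheory GRing.Theory Num.Theory.
Local Open Scope classical_set_scope.
Local Open Scope ring_scope.

(* Conventions: T is the state space; a sequence F_1, F_2, ... with F_n a
   function of (x_1, ..., x_n) is a term [F : forall n, n.-tuple T -> _]. All
   sequences, the process X included, start at index 1: the component at 0 is
   unused and unconstrained. *)

Section power_measure.
Context d (T : measurableType d) (R : realType).

Definition rcons_pair n (p : n.-tuple T * T) : n.+1.-tuple T :=
  [tuple of rcons p.1 p.2].

Lemma measurable_rcons_pair n : measurable_fun setT (@rcons_pair n).
Proof.
apply/measurable_fun_tnthP => i.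
have [lt_in|le_ni] := ltnP i n.
  rewrite (_ : _ \o _ =
    (fun x : n.-tuple T => tnth x (Ordinal lt_in)) \o fst); last first.
    apply/funext => -[x t] /=.
    by rewrite (tnth_nth t) /= nth_rcons size_tuple lt_in (tnth_nth t).
  apply: measurableT_comp; last exact: measurable_fst.
  exact: measurable_tnth.
rewrite (_ : _ \o _ = snd); first exact: measurable_snd.
apply/funext => -[x t] /=.
rewrite (tnth_nth t) /= nth_rcons size_tuple ltnNge le_ni /=.
by rewrite (_ : i = n :> nat) ?eqxx//; apply/eqP; rewrite eqn_leq le_ni -ltnS ltn_ord.
Qed.

HB.instance Definition _ n :=
  isMeasurableFun.Build _ _ _ _ (@rcons_pair n) (@measurable_rcons_pair n).

Section extend_measure.
Context (mu : {sigma_finite_measure set T -> \bar R}) (n : nat).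
Context (nu : {measure set (n.-tuple T) -> \bar R}).

(* nu (x) mu, transported along X^n x X ~ X^(n+1) *)
Definition mext : set (n.+1.-tuple T) -> \bar R :=
  pushforward (product_measure1 nu mu) (@rcons_pair n).

Let mext0 : mext set0 = 0%E.
Proof. by rewrite /mext /pushforward preimage_set0 measure0. Qed.

Let mext_ge0 A : (0 <= mext A)%E.
Proof. exact: measure_ge0. Qed.

Let mext_sigma_additive : semi_sigma_additive mext.
Proof.
apply: measure_semi_sigma_additive; exact: measurable_rcons_pair.
Qed.

HB.instance Definition _ :=
  isMeasure.Build _ _ _ mext mext0 mext_ge0 mext_sigma_additive.

End extend_measure.

(* mu^n; X^0 is a point of mass 1. *)
Fixpoint mpow (mu : {sigma_finite_measure set T -> \bar R}) (n : nat) :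
    {measure set (n.-tuple T) -> \bar R} :=
  match n with
  | 0 => dirac [tuple]
  | m.+1 => mext mu (mpow mu m)
  end.

End power_measure.

Section process.
Context d d' (T : measurableType d) (Omega : measurableType d') (R : realType).

Definition first_vars (X : nat -> {mfun Omega >-> T}) n (w : Omega) :
  n.-tuple T := [tuple X i.+1 w | i < n].

(* For every n >= 1, g_n is a (measurable, nonnegative) density of
   (X_1, ..., X_n) with respect to mu^n under P. *)
Definition is_density_family (mu : {sigma_finite_measure set T -> \bar R})
    (P : probability Omega R) (X : nat -> {mfun Omega >-> T})
    (g : forall n, n.-tuple T -> R) : Prop :=
  forall n, (0 < n)%N ->
    [/\ measurable_fun setT (g n),
        forall x, 0 <= g n x &
        forall A : set (n.-tuple T), measurable A ->
          P (first_vars X n @^-1` A) =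
          (\int[mpow mu n]_(x in A) (g n x)%:E)%E].

Definition Exp (P : probability Omega R) (X : nat -> {mfun Omega >-> T}) n
    (F : n.-tuple T -> R) : \bar R :=
  ('E_P[fun w => F (first_vars X n w)])%E.

End process.

Section rules.
Context d (T : measurableType d) (R : realType).
Implicit Types psi : forall n, n.-tuple T -> R.

Definition stopping_rule psi : Prop :=
  forall n, (0 < n)%N ->
    measurable_fun setT (psi n) /\ forall x, 0 <= psi n x <= 1.

Definition decision_rule k (phi : forall n, n.-tuple T -> 'I_k -> R) : Prop :=
  forall n, (0 < n)%N ->
    [/\ forall j, measurable_fun setT (fun x => phi n x j),
        forall x j, 0 <= phi n x j &
        forall x, \sum_(j < k) phi n x j = 1].

Definition prefix_tuple n (i : 'I_n) (x : n.-tuple T) : i.-tuple T :=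
  [tuple tnth x (widen_ord (ltnW (ltn_ord i)) j) | j < i].

(* (1 - psi_1) ... (1 - psi_(n-1)) as a function of (x_1, ..., x_n) *)
Definition cont psi n (x : n.-tuple T) : R :=
  \prod_(i < n | (0 < i)%N) (1 - psi i (prefix_tuple i x)).

Definition Cset psi n : set (n.-tuple T) := [set x | 0 < cont psi x].

Definition truncated (N : nat) psi : Prop :=
  stopping_rule psi /\ forall x : N.-tuple T, psi N x = 1.

End rules.

Section risk.
Context d d' (T : measurableType d) (Omega : measurableType d') (R : realType).
Context (Theta : Type) (P : Theta -> probability Omega R).
Context (X : nat -> {mfun Omega >-> T}).
Context (k : nat) (th : 'I_k -> Theta) (th0 : Theta) (lam : 'I_k -> 'I_k -> R).
Implicit Types psi : forall n, n.-tuple T -> R.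
Implicit Types phi : forall n, n.-tuple T -> 'I_k -> R.
Local Open Scope ereal_scope.

(* P_v(tau_psi = n) *)
Definition stop_prob (v : Theta) psi n : \bar R :=
  Exp (P v) X (fun x : n.-tuple T => (cont psi x * psi n x)%R).

Definition stop_prob_fin (v : Theta) psi : \bar R :=
  \sum_(1 <= n <oo) stop_prob v psi n.

Definition alpha psi phi (i j : 'I_k) : \bar R :=
  \sum_(1 <= n <oo)
    Exp (P (th i)) X (fun x : n.-tuple T => (cont psi x * psi n x * phi n x j)%R).

Definition mean_size psi : \bar R :=
  if stop_prob_fin th0 psi == 1
  then \sum_(1 <= n <oo) n%:R%:E * stop_prob th0 psi n else +oo.

Definition Lrisk psi phi : \bar R :=
  mean_size psi +
  \sum_(i < k) \sum_(j < k | i != j) (lam i j)%:E * alpha psi phi i j.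

Definition Lopt psi : \bar R :=
  ereal_inf [set Lrisk psi phi | phi in @decision_rule _ T R k].

End risk.

Section truncated_risk.
Context d (T : measurableType d) (R : realType).
Context (mu : {sigma_finite_measure set T -> \bar R}).
Context (Theta : Type) (f : Theta -> forall n, n.-tuple T -> R).
Context (k : nat) (th : 'I_k -> Theta) (th0 : Theta) (lam : 'I_k -> 'I_k -> R).
Implicit Types psi : forall n, n.-tuple T -> R.
Local Open Scope ereal_scope.

Definition lmin n (x : n.-tuple T) : \bar R :=
  \big[Order.min/+oo]_(j < k)
    (\sum_(i < k | i != j) lam i j * f (th i) x)%R%:E.

Definition stage_cost psi n : \bar R :=
  \int[mpow mu n]_x
    ((cont psi x * psi n x)%R%:E * ((n%:R * f th0 x)%R%:E + lmin x)).

Definition LN (N : nat) psi : \bar R := \sum_(1 <= n < N.+1) stage_cost psi n.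

(* Backward induction on the number g = N - m of remaining steps; Vmin_last and
   Vmin_rec below are the recursion in terms of N and m. *)
Fixpoint Vgap (g m : nat) (x : m.-tuple T) : \bar R :=
  match g with
  | 0 => lmin x
  | g'.+1 => Order.min (lmin x)
      ((f th0 x)%:E + \int[mu]_t @Vgap g' m.+1 (rcons_pair (x, t)))
  end.

(* Meaningful for 1 <= m <= N only. *)
Definition Vmin (N m : nat) (x : m.-tuple T) : \bar R := Vgap (N - m) x.

Definition Rcond (N m : nat) (x : m.-tuple T) : \bar R :=
  \int[mu]_t @Vmin N m.+1 (rcons_pair (x, t)).

Definition Rcond0 (N : nat) : \bar R := \int[mu]_t Vmin N [tuple t].

Lemma Vmin_last N (x : N.-tuple T) : Vmin N x = lmin x.
Proof. by rewrite /Vmin subnn. Qed.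

Lemma Vmin_rec N m (x : m.-tuple T) : (m < N)%N ->
  Vmin N x = Order.min (lmin x) ((f th0 x)%:E + Rcond N x).
Proof. by move=> mN; rewrite /Vmin /Rcond /Vmin -(subnSK mN). Qed.

(* The last line of the chain of lower bounds at r; the line above it is the
   same expression at r + 1. *)
Definition lower_bound (N : nat) psi (r : nat) : \bar R :=
  \sum_(1 <= n < r) stage_cost psi n +
  \int[mpow mu r]_x ((cont psi x)%:E * ((r%:R * f th0 x)%R%:E + Vmin N x)).

Definition opt_cond (N : nat) psi (m : nat) : Prop :=
  {ae mpow mu m, forall x : m.-tuple T, Cset psi x ->
    ((\1_[set y : m.-tuple T | (lmin y < (f th0 y)%:E + Rcond N y)%E] x
      <= psi m x) &&
    (psi m x <=
      \1_[set y : m.-tuple T | (lmin y <= (f th0 y)%:E + Rcond N y)%E] x))%R}.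

End truncated_risk.

(* Main.v *)
Require Import Defs.
From HB Require Import structures.
From mathcomp Require Import all_boot all_order all_algebra.
From mathcomp Require Import all_classical all_reals all_analysis.
From mathcomp Require Import measurable_realfun ring lra.

Set Implicit Arguments.
Unset Strict Implicit.
Unset Printing Implicit Defensive.
Import Order.TTheory GRing.Theory Num.Theory.
Local Open Scope classical_set_scope.
Local Open Scope ring_scope.

(** For a rule truncated at N, the minimal risk over decision rules splits into
    stages: deciding after n observations costs at least l_n, and this is
    achieved by always choosing a hypothesis of minimal cost.  Hence the minimal
    risk is L_N(psi) (Lopt_truncated).

    Everything else compares L_N(psi) with the lower bounds B_r.  As psi_N = 1,
    L_N(psi) = B_N (LN_truncated), so it suffices to look at B_(r+1) - B_r.
    Integrate the last coordinate out of the last term of B_(r+1) with Tonelli: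
    V_(r+1) becomes R_r, and f^(r+1) becomes f^r because both are densities of
    initial segments of one process (integral_marginal).  This gives
    (lower_bound_step), with C = (1 - psi_1) ... (1 - psi_(r-1)),
<<
      B_(r+1) - B_r = int C (psi_r l_r + (1 - psi_r) (f^r + R_r)
                             - min (l_r, f^r + R_r)) dmu^r.
>>
    The integrand is nonnegative, as an average of two numbers is at least their
    minimum (mixture_ge_min).  L_N(psi) is finite (stage_cost_lty), so
    equality holds if and only if the integrand vanishes almost everywhere
    (ge0_integral_eq_ae), that is, if on the set C > 0 the weight psi_r sits on
    a minimal term (mixture_eq_min).  Downward induction on r yields the chain
    of bounds and the equality condition (LN_lower_bound).

    Finally B_1 = 1 + int V_1 does not depend on psi (lower_bound1), and the
    rule that stops as soon as l_n <= f^n + R_n satisfies the equality condition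
    at every stage, so B_1 is the minimum and the condition characterizes the
    minimizers. *)

(** * Tuples and integration against powers of a measure *)

Section tuples.
Context d (T : measurableType d).

Lemma tnth_rcons_pair_lt n (x : n.-tuple T) t (j : 'I_n.+1) (jn : (j < n)%N) :
  tnth (rcons_pair (x, t)) j = tnth x (Ordinal jn).
Proof. by rewrite !(tnth_nth t) /= nth_rcons size_tuple jn. Qed.

Lemma tnth_rcons_pair_max n (x : n.-tuple T) t (j : 'I_n.+1) :
  (n <= j)%N -> tnth (rcons_pair (x, t)) j = t.
Proof.
move=> nj; have jn : j = n :> nat by apply/eqP; rewrite eqn_leq nj -ltnS ltn_ord.
by rewrite (tnth_nth t) /= nth_rcons size_tuple jn ltnn eqxx.
Qed.

Lemma prefix_rcons_pair n (i : 'I_n) (x : n.-tuple T) t :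
  prefix_tuple (widen_ord (leqnSn n) i) (rcons_pair (x, t)) = prefix_tuple i x.
Proof.
apply: eq_from_tnth => j; rewrite !tnth_mktuple tnth_rcons_pair_lt.
  exact: ltn_trans (ltn_ord j) (ltn_ord i).
by move=> ji; congr tnth; exact: val_inj.
Qed.

Lemma prefix_rcons_pair_max n (x : n.-tuple T) t :
  prefix_tuple (@ord_max n) (rcons_pair (x, t)) = x.
Proof.
apply: eq_from_tnth => j; rewrite !tnth_mktuple tnth_rcons_pair_lt.
  exact: ltn_ord j.
by move=> jn; congr tnth; exact: val_inj.
Qed.

Lemma measurable_prefix_tuple n (i : 'I_n) :
  measurable_fun setT (@prefix_tuple _ T n i).
Proof.
apply/measurable_fun_tnthP => j.
rewrite (_ : _ \o _ = (@tnth n T)^~ (widen_ord (ltnW (ltn_ord i)) j)).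
  exact: measurable_tnth.
by apply/funext => x /=; rewrite tnth_mktuple.
Qed.

End tuples.

(** Tonelli's theorem and the Radon-Nikodym derivative apply to packaged
    sigma-finite measures; an integral depends on the set function only, so this
    equality transports them to [nu]. *)
Lemma sigma_finite_measure_of d (T : measurableType d) (R : realType)
    (nu : {measure set T -> \bar R}) : sigma_finite setT nu ->
  exists m : {sigma_finite_measure set T -> \bar R},
    m = nu :> (set T -> \bar R).
Proof.
move=> sf; pose H1 := isSFinite.Build _ _ _ _ (sfinite_measure_sigma_finite sf).
pose H2 := isSigmaFinite.Build _ _ _ _ sf.
pose m := HB.pack_for {sigma_finite_measure set T -> \bar R}
  (Measure.sort nu) H1 H2.
by exists m.
Qed.

Section power_measure_integral.
Context d (T : measurableType d) (R : realType).
Context (mu : {sigma_finite_measure set T -> \bar R}).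
Local Open Scope ereal_scope.

(** Products of an exhausting sequence for [mpow mu n] with one for [mu], pulled
    back along the inverse [un] of [rcons_pair], exhaust the tuples. *)
Lemma mpow_sigma_finite n : sigma_finite setT (mpow mu n).
Proof.
elim: n => [|n IH] /=.
  by exists (fun=> setT) => [|i]; rewrite ?bigcup_const//= diracT ltry.
have /sigma_finiteP[F [UF ndF mF]] := IH.
have /sigma_finiteP[G [UG ndG mG]] := sigma_finiteT mu.
pose un (x : n.+1.-tuple T) := (prefix_tuple (@ord_max n) x, tnth x ord_max).
have mun : measurable_fun setT un.
  apply: measurable_fun_pair; first exact: measurable_prefix_tuple.
  exact: measurable_tnth.
have unK : un \o @rcons_pair _ T n = id.
  apply/funext => -[x t].
  by rewrite /= /un prefix_rcons_pair_max tnth_rcons_pair_max.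
exists (fun i => un @^-1` (F i `*` G i)) => [|i].
  rewrite -preimage_bigcup; apply/esym; rewrite -subTset => x _.
  have : setT (un x).1 by []. have : setT (un x).2 by [].
  rewrite {1}UG {1}UF => -[j _ Gj] [i _ Fi]; exists (maxn i j) => //; split.
    by move: Fi; exact/subsetPset/ndF/leq_maxl.
  by move: Gj; exact/subsetPset/ndG/leq_maxr.
have [mFi Fi_fin] := mF i; have [mGi Gi_fin] := mG i; split.
  by rewrite -[X in measurable X]setTI; apply: mun => //; exact: measurableX.
rewrite /mext /pushforward -comp_preimage unK preimage_id product_measure1E //.
by rewrite lte_mul_pinfty // ge0_fin_numE.
Qed.

Lemma measurable_integral_rcons n (g : n.+1.-tuple T -> \bar R) :
  measurable_fun setT g -> (forall x, 0 <= g x) ->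
  measurable_fun setT (fun x : n.-tuple T => \int[mu]_t g (rcons_pair (x, t))).
Proof.
move=> mg g0.
apply: (@measurable_fun_fubini_tonelli_F _ _ _ _ _ mu
  (g \o @rcons_pair _ T n)) => [|x]; last exact: g0.
by apply: measurableT_comp => //; exact: measurable_rcons_pair.
Qed.

Lemma integral_mpowS n (g : n.+1.-tuple T -> \bar R) :
  measurable_fun setT g -> (forall x, 0 <= g x) ->
  \int[mpow mu n.+1]_x g x =
  \int[mpow mu n]_x \int[mu]_t g (rcons_pair (x, t)).
Proof.
move=> mg g0.
transitivity (\int[mpow mu n \x mu]_z (g \o @rcons_pair _ T n) z).
  rewrite /= /mext.
  rewrite (@ge0_integral_pushforward _ _ _ _ _ (@rcons_pair _ T n)
    (@measurable_rcons_pair _ T n)) //.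
have [nu nuE] := sigma_finite_measure_of (mpow_sigma_finite n).
rewrite -nuE (@fubini_tonelli1 _ _ _ _ _ nu mu) //.
  by apply: measurableT_comp => //; exact: measurable_rcons_pair.
by move=> x; exact: g0.
Qed.

Lemma integral_mpow1 (g : 1.-tuple T -> \bar R) :
  measurable_fun setT g -> (forall x, 0 <= g x) ->
  \int[mpow mu 1]_x g x = \int[mu]_t g [tuple t].
Proof.
move=> mg g0; rewrite integral_mpowS //= integral_dirac //; last first.
  exact: (measurable_integral_rcons mg g0).
rewrite diracT mul1e; apply: eq_integral => t _; congr g.
exact: val_inj.
Qed.

End power_measure_integral.

(** * Densities of the initial segments *)

Section density.
Context d d' (T : measurableType d) (Omega : measurableType d') (R : realType).
Context (mu : {sigma_finite_measure set T -> \bar R}).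
Context (P : probability Omega R) (X : nat -> {mfun Omega >-> T}).
Context (f : forall n, n.-tuple T -> R).
Hypothesis hf : is_density_family mu P X f.
Local Open Scope ereal_scope.

Lemma measurable_first_vars n : measurable_fun setT (first_vars X n).
Proof.
apply/measurable_fun_tnthP => i.
rewrite (_ : _ \o _ = X i.+1); first exact: measurable_funPT.
by apply/funext => w /=; rewrite tnth_mktuple.
Qed.

Lemma first_varsS n w :
  first_vars X n.+1 w = rcons_pair (first_vars X n w, X n.+1 w).
Proof.
apply: eq_from_tnth => j; rewrite tnth_mktuple.
have [jn|nj] := ltnP j n; first by rewrite tnth_rcons_pair_lt tnth_mktuple.
have jn : j = n :> nat by apply/eqP; rewrite eqn_leq nj -ltnS ltn_ord.
by rewrite tnth_rcons_pair_max // jn.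
Qed.

(** The density [f] agrees almost everywhere with the Radon-Nikodym derivative
    of the law of the segment, which satisfies the change of variables. *)
Lemma integral_first_vars n (g : n.-tuple T -> \bar R) : (0 < n)%N ->
  measurable_fun setT g -> (forall x, 0 <= g x) ->
  \int[P]_w g (first_vars X n w) = \int[mpow mu n]_x (g x * (f x)%:E).
Proof.
move=> n0 mg g0; have [mf f0 Pf] := hf n0.
have mfE : measurable_fun setT (EFin \o @f n) by exact/measurable_EFinP.
pose H := isMeasurableFun.Build _ _ _ _ _ (@measurable_first_vars n).
pose Y : {mfun Omega >-> n.-tuple T} := HB.pack (first_vars X n) H.
have law A : measurable A ->
    distribution P Y A = \int[mpow mu n]_(x in A) (f x)%:E by exact: Pf.
rewrite -(ge0_integral_distribution Y) //.
have [nu nuE] := sigma_finite_measure_of (mpow_sigma_finite mu n).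
rewrite -nuE in law *.
have dom : distribution P Y `<< nu.
  apply/null_content_dominatesP => A mA A0.
  by rewrite law //; apply: null_set_integral => //; exact: measurable_funTS.
rewrite -(Radon_Nikodym_SigmaFinite.change_of_variables dom) //.
have mRN := measurable_int _ (Radon_Nikodym_SigmaFinite.f_integrable dom).
apply: ae_eq_integral => //; [exact: emeasurable_funM|exact: emeasurable_funM|].
have := integral_ae_eq measurableT
  (Radon_Nikodym_SigmaFinite.f_integrable dom) mfE.
have h E : E `<=` setT -> measurable E ->
    \int[nu]_(x in E) Radon_Nikodym_SigmaFinite.f (distribution P Y) nu x
    = \int[nu]_(x in E) (EFin \o @f n) x.
  move=> _ mE; rewrite -(Radon_Nikodym_SigmaFinite.f_integral dom mE).
  exact: law.
by move=> /(_ h); apply: filterS => x /(_ I) e _ /=; rewrite e.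
Qed.

End density.

(** * Averages of two costs, and integrals of ordered functions *)

Lemma indic_pred (T : Type) (R : pzRingType) (b : T -> bool) (x : T) :
  \1_[set y | b y] x = (b x)%:R :> R.
Proof.
by rewrite indicE (_ : (x \in _) = b x) //; apply/idP/idP; rewrite in_setE.
Qed.

Lemma fin_num_addeI (R : realType) (x : \bar R) :
  x \is a fin_num -> injective (+%E x).
Proof. by move: x => [x| |] // _ [y| |] [z| |] //= [] /addrI ->. Qed.

Section mixtures.
Context (R : realType).
Local Open Scope ereal_scope.

Lemma mixture_ge_min (p l : R) (c : \bar R) : (0 <= p <= 1)%R ->
  mine l%:E c <= p%:E * l%:E + (1 - p)%:E * c.
Proof.
move=> /andP[p0 p1]; case: c => [c| |].
- rewrite -!EFinM -EFinD -EFin_min lee_fin; case: (leP l c) => lc; nra.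
- rewrite min_l ?leey //; move: p1; rewrite le_eqVlt => /predU1P[->|p1].
    by rewrite subrr mul0e mul1e adde0.
  by rewrite gt0_muley ?lte_fin ?subr_gt0 // addey // leey.
- by rewrite min_r ?leNye // leNye.
Qed.

(** The excess over the minimum is the distance between the two terms times the
    weight of the larger one, so it vanishes exactly when a strictly larger term
    gets weight zero; the convention [0 * +oo = 0] extends this to [c = +oo]. *)
Lemma mixture_eq_min (p l : R) (c : \bar R) : (0 <= p <= 1)%R -> 0 <= c ->
  mine l%:E c = p%:E * l%:E + (1 - p)%:E * c <->
  ((l%:E < c)%E%:R <= p <= (l%:E <= c)%E%:R)%R.
Proof.
move=> /andP[p0 p1]; case: c => [c| |] // _.
- rewrite -!EFinM -EFinD -EFin_min lte_fin lee_fin.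
  case: (ltgtP l c) => lc /=; rewrite ?p0 ?p1 ?andbT /=.
  + split=> [[]|p1']; first by nra.
    by rewrite (_ : p = 1%R) //; [congr EFin; ring|lra].
  + split=> [[]|p0']; first by nra.
    by rewrite (_ : p = 0%R) //; [congr EFin; ring|lra].
  + by split=> // _; rewrite lc; congr EFin; ring.
- rewrite ltry leey min_l ?leey //= p1 andbT; split=> [|p1'].
    move: p1; rewrite le_eqVlt => /predU1P[->//|p1].
    by rewrite gt0_muley ?lte_fin ?subr_gt0 // addey.
  by rewrite (_ : p = 1%R) ?subrr ?mul0e ?mul1e ?adde0 //; lra.
Qed.

End mixtures.

Section integral_equality.
Context d (T : measurableType d) (R : realType).
Context (m : {measure set T -> \bar R}).
Local Open Scope ereal_scope.

(** Finiteness of [g] makes [h - g] meaningful, and finiteness of its integral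
    makes it cancellable: the integrals agree iff the nonnegative [h - g] has
    integral zero. *)
Lemma ge0_integral_eq_ae (g h : T -> \bar R) :
  measurable_fun setT g -> measurable_fun setT h ->
  (forall x, 0 <= g x) -> (forall x, g x \is a fin_num) ->
  (forall x, g x <= h x) -> \int[m]_x g x < +oo ->
  \int[m]_x h x = \int[m]_x g x <-> ae_eq m setT g h.
Proof.
move=> mg mh g0 gfin gh intg.
have mhg : measurable_fun setT (h \- g) by exact: emeasurable_funB.
have hg0 x : 0 <= (h \- g) x by rewrite /= sube_ge0 // gfin.
have -> : \int[m]_x h x = \int[m]_x g x + \int[m]_x (h \- g) x.
  rewrite -ge0_integralD //; apply: eq_integral => x _ /=.
  by rewrite addeC subeK.
have gfin' : \int[m]_x g x \is a fin_num.
  by rewrite ge0_fin_numE // integral_ge0.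
have -> : \int[m]_x (h \- g) x = \int[m]_x `|(h \- g) x|.
  by apply: eq_integral => x _; rewrite gee0_abs.
split=> [e|e].
  have /(ae_eq_integral_abs m measurableT mhg) : \int[m]_x `|(h \- g) x| = 0.
    by apply: (fin_num_addeI gfin'); rewrite e adde0.
  apply: filterS => x /(_ I) /= e0 _.
  by rewrite -[RHS](@subeK _ _ (g x)) ?gfin // e0 add0e.
have /(ae_eq_integral_abs m measurableT mhg) -> : ae_eq m setT (h \- g) (cst 0).
  by apply: filterS e => x /(_ I) /= <- _; rewrite subee.
by rewrite adde0.
Qed.

End integral_equality.

(** * The probability of not having stopped *)

Section stopping.
Context d (T : measurableType d) (R : realType).
Context (psi : forall n, n.-tuple T -> R).

Lemma contS n (x : n.-tuple T) t : (0 < n)%N ->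
  cont psi (rcons_pair (x, t)) = cont psi x * (1 - psi x).
Proof.
move=> n0; rewrite /cont big_mkcond big_ord_recr /= n0 prefix_rcons_pair_max.
congr (_ * _); rewrite [RHS]big_mkcond; apply: eq_bigr => i _ /=.
case: ifP => // i0.
exact: (congr1 (fun y : i.-tuple T => 1 - psi y) (prefix_rcons_pair i x t)).
Qed.

Lemma cont1 (x : 1.-tuple T) : cont psi x = 1.
Proof. by rewrite /cont big_mkcond big_ord1. Qed.

Hypothesis psi_rule : stopping_rule psi.

Lemma measurable_cont n : measurable_fun setT (@cont _ T R psi n).
Proof.
rewrite /cont; under eq_fun do rewrite big_mkcond.
apply: measurable_prod => i _; case: (boolP (0 < i)%N) => // i0.
apply: measurable_funB => //; apply: measurableT_comp.
  by have [] := psi_rule i0.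
exact: measurable_prefix_tuple.
Qed.

Lemma cont_ge0 n (x : n.-tuple T) : 0 <= cont psi x.
Proof.
apply: prodr_ge0 => i i0; have [_ /(_ (prefix_tuple i x))/andP[]] := psi_rule i0.
by rewrite subr_ge0.
Qed.

Lemma cont_le1 n (x : n.-tuple T) : cont psi x <= 1.
Proof.
apply: prodr_ile1 => i i0.
have [_ /(_ (prefix_tuple i x))/andP[p0 p1]] := psi_rule i0.
by rewrite subr_ge0 p1 lerBlDr lerDl.
Qed.

End stopping.

(** The factor [1 - psi_N] vanishes. *)
Lemma cont_truncated d (T : measurableType d) (R : realType)
    (psi : forall n, n.-tuple T -> R) N n (x : n.-tuple T) :
  (0 < N)%N -> truncated N psi -> (N < n)%N -> cont psi x = 0.
Proof.
move=> N0 [_ psiN] Nn; rewrite /cont (bigD1 (Ordinal Nn)) //=.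
by rewrite psiN subrr mul0r.
Qed.

(** * Costs of deciding and the backward recursion *)

Section costs.
Context d (T : measurableType d) (R : realType).
Context (mu : {sigma_finite_measure set T -> \bar R}).
Context (Theta : Type) (f : Theta -> forall n, n.-tuple T -> R).
Context (k : nat) (th : 'I_k -> Theta) (th0 : Theta) (lam : 'I_k -> 'I_k -> R).
Hypothesis mf : forall v n, (0 < n)%N -> measurable_fun setT (@f v n).
Hypothesis f0 : forall v n (x : n.-tuple T), (0 < n)%N -> 0 <= f v x.
Hypothesis hk : (0 < k)%N.
Hypothesis hlam : forall i j, i != j -> 0 <= lam i j.

Definition decision_cost (j : 'I_k) n (x : n.-tuple T) : R :=
  \sum_(i < k | i != j) lam i j * f (th i) x.

Lemma measurable_decision_cost j n : (0 < n)%N ->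
  measurable_fun setT (@decision_cost j n).
Proof.
move=> n0; rewrite /decision_cost; under eq_fun do rewrite big_mkcond.
apply: measurable_sum => i; case: (boolP (i != j)) => // _.
by apply: measurable_funM => //; exact: mf.
Qed.

Lemma decision_cost_ge0 j n (x : n.-tuple T) : (0 < n)%N ->
  0 <= decision_cost j x.
Proof.
by move=> n0; apply: sumr_ge0 => i ij; rewrite mulr_ge0 ?hlam ?f0.
Qed.

Local Open Scope ereal_scope.
Local Notation lmin := (lmin f th lam).
Local Notation Vgap := (Vgap mu f th th0 lam).
Local Notation Vmin := (Vmin mu f th th0 lam).
Local Notation Rcond := (Rcond mu f th th0 lam).

Lemma lmin_le j n (x : n.-tuple T) : lmin x <= (decision_cost j x)%:E.
Proof. exact: bigmin_le. Qed.

Lemma lmin_attained n (x : n.-tuple T) :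
  exists j, lmin x = (decision_cost j x)%:E.
Proof.
rewrite /lmin (@bigmin_eq_arg _ _ _ _ (Ordinal hk)) //; last first.
  by move=> *; exact: leey.
by eexists.
Qed.

Lemma lmin_ge0 n (x : n.-tuple T) : (0 < n)%N -> 0 <= lmin x.
Proof.
by move=> n0; have [j ->] := lmin_attained x; rewrite lee_fin decision_cost_ge0.
Qed.

Lemma lmin_fin_num n (x : n.-tuple T) : lmin x \is a fin_num.
Proof. by have [j ->] := lmin_attained x. Qed.

Lemma measurable_lmin n : (0 < n)%N -> measurable_fun setT (@lmin n).
Proof.
move=> n0; rewrite (_ : @lmin n =
  fun x => \big[Order.min/+oo]_(j < k) (decision_cost j x)%:E) //.
elim: (index_enum _) => [|j s IH].
  rewrite (_ : (fun=> _) = cst +oo) //.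
  by apply/funext => x; rewrite big_nil.
rewrite (_ : (fun=> _) = fun x => mine (decision_cost j x)%:E
  (\big[Order.min/+oo]_(i <- s) (decision_cost i x)%:E)); last first.
  by apply/funext => x; rewrite big_cons.
apply: measurable_mine => //.
by apply/measurable_EFinP; exact: measurable_decision_cost.
Qed.

Lemma Vgap_ge0 g n (x : n.-tuple T) : (0 < n)%N -> 0 <= Vgap g x.
Proof.
elim: g n x => [|g IH] n x n0 /=; first exact: lmin_ge0.
rewrite le_min lmin_ge0 //= adde_ge0 ?lee_fin ?f0 //.
by apply: integral_ge0 => t _; exact: IH.
Qed.

Lemma measurable_Vgap g n : (0 < n)%N -> measurable_fun setT (@Vgap g n).
Proof.
elim: g n => [|g IH] n n0 /=; first exact: measurable_lmin.
apply: measurable_mine; first exact: measurable_lmin.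
apply: emeasurable_funD; first by apply/measurable_EFinP; exact: mf.
apply: measurable_integral_rcons; first exact: IH.
by move=> x; exact: Vgap_ge0.
Qed.

Lemma Vmin_ge0 N n (x : n.-tuple T) : (0 < n)%N -> 0 <= Vmin N x.
Proof. exact: Vgap_ge0. Qed.

Lemma measurable_Vmin N n : (0 < n)%N -> measurable_fun setT (@Vmin N n).
Proof. exact: measurable_Vgap. Qed.

Lemma Rcond_ge0 N n (x : n.-tuple T) : 0 <= Rcond N x.
Proof. by apply: integral_ge0 => t _; exact: Vmin_ge0. Qed.

Lemma measurable_Rcond N n : measurable_fun setT (@Rcond N n).
Proof.
apply: measurable_integral_rcons; first exact: measurable_Vmin.
by move=> x; exact: Vmin_ge0.
Qed.

Lemma Vmin_le_lmin N n (x : n.-tuple T) : Vmin N x <= lmin x.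
Proof. by rewrite /Vmin; case: (N - n)%N => [//|g] /=; rewrite ge_min lexx. Qed.

Lemma Vmin_fin_num N n (x : n.-tuple T) : (0 < n)%N -> Vmin N x \is a fin_num.
Proof.
move=> n0; rewrite ge0_fin_numE ?Vmin_ge0 //.
by rewrite (le_lt_trans (Vmin_le_lmin _ _)) // ltey_eq lmin_fin_num.
Qed.

End costs.

(** * The chain of lower bounds *)

Section backward_induction.
Context d d' (T : measurableType d) (Omega : measurableType d') (R : realType).
Context (mu : {sigma_finite_measure set T -> \bar R}).
Context (Theta : Type) (P : Theta -> probability Omega R).
Context (X : nat -> {mfun Omega >-> T}).
Context (f : Theta -> forall n, n.-tuple T -> R).
Hypothesis hf : forall v, is_density_family mu (P v) X (f v).
Context (k : nat) (th : 'I_k -> Theta) (th0 : Theta) (lam : 'I_k -> 'I_k -> R).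
Hypothesis hk : (0 < k)%N.
Hypothesis hlam : forall i j, i != j -> 0 <= lam i j.
Local Open Scope ereal_scope.
Local Notation lmin := (lmin f th lam).
Local Notation Vmin := (Vmin mu f th th0 lam).
Local Notation Rcond := (Rcond mu f th th0 lam).
Local Notation stage_cost := (stage_cost mu f th th0 lam).
Local Notation LN := (LN mu f th th0 lam).
Local Notation lower_bound := (lower_bound mu f th th0 lam).
Local Notation opt_cond := (opt_cond mu f th th0 lam).

Lemma measurable_density v n : (0 < n)%N -> measurable_fun setT (@f v n).
Proof. by move=> n0; have [] := hf v n0. Qed.

Lemma density_ge0 v n (x : n.-tuple T) : (0 < n)%N -> (0 <= f v x)%R.
Proof. by move=> n0; have [] := hf v n0. Qed.

Let mf := measurable_density.
Let f0 := density_ge0.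

Lemma integral_density v n : (0 < n)%N -> \int[mpow mu n]_x (f v x)%:E = 1.
Proof.
move=> n0; have [_ _ /(_ setT measurableT)] := hf v n0.
by rewrite preimage_setT probability_setT.
Qed.

(** Consistency of the densities, in integrated form: both sides are the
    expectation of the same function of the first [n] observations. *)
Lemma integral_marginal v n (g : n.+1.-tuple T -> \bar R)
    (h : n.-tuple T -> \bar R) : (0 < n)%N ->
  measurable_fun setT g -> (forall x, 0 <= g x) ->
  measurable_fun setT h -> (forall x, 0 <= h x) ->
  (forall x t, g (rcons_pair (x, t)) = h x) ->
  \int[mpow mu n.+1]_x (g x * (f v x)%:E) =
  \int[mpow mu n]_x (h x * (f v x)%:E).
Proof.
move=> n0 mg g0 mh h0 gh.
rewrite -(integral_first_vars (hf v)) // -(integral_first_vars (hf v)) //.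
by apply: eq_integral => w _; rewrite first_varsS gh.
Qed.

Section rule.
Context (psi : forall n, n.-tuple T -> R) (N : nat).
Hypothesis psi_rule : stopping_rule psi.

Let mpsi n : (0 < n)%N -> measurable_fun setT (@psi n).
Proof. by move=> n0; have [] := psi_rule n0. Qed.

Let psi01 n (x : n.-tuple T) : (0 < n)%N -> (0 <= psi x <= 1)%R.
Proof. by move=> n0; have [] := psi_rule n0. Qed.

Let mcont n := measurable_cont psi_rule (n := n).
Let cont0 := cont_ge0 psi_rule.

Lemma measurable_sampling_cost n (c : R) : (0 < n)%N ->
  measurable_fun setT (fun x : n.-tuple T => (c * f th0 x)%:E).
Proof.
by move=> n0; apply/measurable_EFinP/measurable_funM => //; exact: mf.
Qed.

Lemma measurable_cont_next n : (0 < n)%N ->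
  measurable_fun setT (fun x : n.-tuple T => cont psi x * (1 - psi x))%R.
Proof.
move=> n0; apply: measurable_funM; first exact: mcont.
by apply: measurable_funB => //; exact: mpsi.
Qed.

Lemma cont_next_ge0 n (x : n.-tuple T) : (0 < n)%N ->
  (0 <= cont psi x * (1 - psi x))%R.
Proof.
by move=> n0; rewrite mulr_ge0 ?subr_ge0 //; have /andP[] := psi01 x n0.
Qed.

Lemma measurable_stage_integrand n : (0 < n)%N ->
  measurable_fun setT (fun x : n.-tuple T =>
    (cont psi x * psi x)%:E * ((n%:R * f th0 x)%:E + lmin x)).
Proof.
move=> n0; apply: emeasurable_funM.
  by apply/measurable_EFinP/measurable_funM; [exact: mcont|exact: mpsi].
apply: emeasurable_funD; first exact: measurable_sampling_cost.
exact: measurable_lmin.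
Qed.

Lemma stage_integrand_ge0 n (x : n.-tuple T) : (0 < n)%N ->
  0 <= (cont psi x * psi x)%:E * ((n%:R * f th0 x)%:E + lmin x).
Proof.
move=> n0; rewrite mule_ge0 ?adde_ge0 ?lee_fin ?mulr_ge0 ?f0 ?lmin_ge0 //.
by have /andP[] := psi01 x n0.
Qed.

(** The cost of stopping with probability [psi] at stage [r] and of going on
    optimally otherwise, weighted by the probability of reaching that stage. *)
Definition continuation_cost r (x : r.-tuple T) : \bar R :=
  (cont psi x)%:E * ((r%:R * f th0 x)%:E +
    ((psi x)%:E * lmin x + (1 - psi x)%:E * ((f th0 x)%:E + Rcond N x))).

(** The first summand is the integrand of the stage cost; the second one is what
    remains of the last integrand of the lower bound at [r.+1] after the last
    observation has been integrated out. *)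
Lemma continuation_costE r (x : r.-tuple T) : continuation_cost x =
  (cont psi x * psi x)%:E * ((r%:R * f th0 x)%:E + lmin x) +
  ((cont psi x * (1 - psi x) * r.+1%:R)%:E * (f th0 x)%:E +
   (cont psi x * (1 - psi x))%:E * Rcond N x).
Proof.
rewrite /continuation_cost; have := lmin_fin_num f th lam hk x.
case: (lmin x) => // l _.
rewrite (muleDr _ (z := Rcond N x)) ?fin_num_adde_defr //.
rewrite -!EFinM addeA -EFinD addeA -EFinD muleDr ?fin_num_adde_defr //.
rewrite muleA -!EFinM addeA -EFinD.
congr (_%:E + _); rewrite -(natr1 r); ring.
Qed.

(** Going on multiplies [cont] by [1 - psi], a function of the first [r]
    observations, so the last observation can be integrated out of the density
    and of the next [Vmin] separately. *)
Lemma lower_bound_step r : (0 < r)%N -> (r < N)%N ->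
  lower_bound N psi r.+1 =
  \sum_(1 <= n < r) stage_cost psi n + \int[mpow mu r]_x continuation_cost x.
Proof.
move=> r0 rN; rewrite /lower_bound big_nat_recr //= -addeA; congr (_ + _).
under [RHS]eq_integral do rewrite continuation_costE.
have m2 : measurable_fun setT (fun x : r.-tuple T =>
    (cont psi x * (1 - psi x) * r.+1%:R)%:E * (f th0 x)%:E).
  apply: emeasurable_funM; apply/measurable_EFinP; last exact: mf.
  by apply: measurable_funM => //; exact: measurable_cont_next.
have m3 : measurable_fun setT (fun x : r.-tuple T =>
    (cont psi x * (1 - psi x))%:E * Rcond N x).
  apply: emeasurable_funM.
    by apply/measurable_EFinP; exact: measurable_cont_next.
  exact: measurable_Rcond.
have ge2 (x : r.-tuple T) :
    0 <= (cont psi x * (1 - psi x) * r.+1%:R)%:E * (f th0 x)%:E.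
  by rewrite -EFinM lee_fin mulr_ge0 ?f0 // mulr_ge0 // cont_next_ge0.
have ge3 (x : r.-tuple T) : 0 <= (cont psi x * (1 - psi x))%:E * Rcond N x.
  by rewrite mule_ge0 ?lee_fin ?cont_next_ge0 //; exact: Rcond_ge0.
rewrite ge0_integralD //=; last 4 first.
- by move=> x _; exact: stage_integrand_ge0.
- exact: measurable_stage_integrand.
- by move=> x _; exact: adde_ge0.
- exact: emeasurable_funD.
congr (_ + _); rewrite ge0_integralD //.
(* Split the last integral of the bound at r.+1 into its two parts: the first
   is computed by marginalization, the second by Tonelli. *)
transitivity (\int[mpow mu r.+1]_x
  ((cont psi x * r.+1%:R)%:E * (f th0 x)%:E + (cont psi x)%:E * Vmin N x)).
  apply: eq_integral => x _; rewrite muleDr ?fin_num_adde_defr //.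
  by rewrite -!EFinM mulrA.
have mV : measurable_fun setT (@Vmin N r.+1) by exact: measurable_Vmin.
have V0 (x : r.+1.-tuple T) : 0 <= Vmin N x by exact: Vmin_ge0.
have mcV : measurable_fun setT
    (fun x : r.+1.-tuple T => (cont psi x)%:E * Vmin N x).
  by apply: emeasurable_funM => //; apply/measurable_EFinP; exact: mcont.
have cV0 (x : r.+1.-tuple T) : 0 <= (cont psi x)%:E * Vmin N x.
  by rewrite mule_ge0 // lee_fin.
have mcr : measurable_fun setT
    (fun x : r.+1.-tuple T => (cont psi x * r.+1%:R)%:E).
  by apply/measurable_EFinP/measurable_funM => //; exact: mcont.
have cr0 (x : r.+1.-tuple T) : 0 <= (cont psi x * r.+1%:R)%:E.
  by rewrite lee_fin mulr_ge0.
rewrite ge0_integralD //; last 2 first.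
- by move=> x _; rewrite mule_ge0 // lee_fin f0.
- by apply: emeasurable_funM => //; apply/measurable_EFinP; exact: mf.
congr (_ + _).
  rewrite (integral_marginal th0 (h := fun x : r.-tuple T =>
    (cont psi x * (1 - psi x) * r.+1%:R)%:E)) //.
  - by apply/measurable_EFinP/measurable_funM => //; exact: measurable_cont_next.
  - by move=> x; rewrite lee_fin mulr_ge0 // cont_next_ge0.
  - by move=> x t; rewrite contS.
rewrite integral_mpowS //; apply: eq_integral => x _.
rewrite /Rcond -ge0_integralZl_EFin ?cont_next_ge0 //.
- by apply: eq_integral => t _; rewrite contS.
- apply: (measurableT_comp (g := fun t => rcons_pair (x, t)) mV).
  apply: (measurableT_comp (g := fun t => (x, t))
    (@measurable_rcons_pair _ T r)) => //.
  exact: measurable_fun_pair.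
Qed.

Lemma measurable_continuation_cost r : (0 < r)%N ->
  measurable_fun setT (@continuation_cost r).
Proof.
move=> r0; apply: emeasurable_funM.
  by apply/measurable_EFinP; exact: mcont.
apply: emeasurable_funD; first exact: measurable_sampling_cost.
apply: emeasurable_funD; apply: emeasurable_funM.
- by apply/measurable_EFinP; exact: mpsi.
- exact: measurable_lmin.
- by apply/measurable_EFinP/measurable_funB => //; exact: mpsi.
- apply: emeasurable_funD; first by apply/measurable_EFinP; exact: mf.
  exact: measurable_Rcond.
Qed.

(** The last integrand of the lower bound at [r]. *)
Definition bellman_cost r (x : r.-tuple T) : \bar R :=
  (cont psi x)%:E * ((r%:R * f th0 x)%:E + Vmin N x).

Lemma measurable_bellman_cost r : (0 < r)%N ->
  measurable_fun setT (@bellman_cost r).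
Proof.
move=> r0; apply: emeasurable_funM.
  by apply/measurable_EFinP; exact: mcont.
apply: emeasurable_funD; first exact: measurable_sampling_cost.
exact: measurable_Vmin.
Qed.

Lemma bellman_cost_ge0 r (x : r.-tuple T) : (0 < r)%N -> 0 <= bellman_cost x.
Proof.
move=> r0; rewrite mule_ge0 ?adde_ge0 ?lee_fin ?mulr_ge0 ?f0 //.
exact: Vmin_ge0.
Qed.

Lemma bellman_cost_fin_num r (x : r.-tuple T) : (0 < r)%N ->
  bellman_cost x \is a fin_num.
Proof. by move=> r0; rewrite fin_numM // fin_numD //= Vmin_fin_num. Qed.

Lemma bellman_cost_le r (x : r.-tuple T) : (0 < r)%N -> (r < N)%N ->
  bellman_cost x <= continuation_cost x.
Proof.
move=> r0 rN; rewrite lee_wpmul2l ?lee_fin // leeD2l // Vmin_rec //.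
have := lmin_fin_num f th lam hk x; case: (lmin x) => // l _.
exact/mixture_ge_min/psi01.
Qed.

(** Off [Cset] both costs vanish; on it the factor [cont] and the finite term
    [r * f] cancel, which leaves the equality case for averages. *)
Lemma bellman_cost_eq r (x : r.-tuple T) : (0 < r)%N -> (r < N)%N ->
  bellman_cost x = continuation_cost x <-> (Cset psi x ->
    ((lmin x < (f th0 x)%:E + Rcond N x)%E%:R <= psi x <=
     (lmin x <= (f th0 x)%:E + Rcond N x)%E%:R)%R).
Proof.
move=> r0 rN; rewrite /Cset /= /bellman_cost /continuation_cost.
have := cont0 x; rewrite le_eqVlt => /predU1P[<-|c0].
  by rewrite !mul0e ltxx.
have cfin_inj : injective ( *%E (cont psi x)%:E).
  apply: (can_inj (g := *%E ((cont psi x)^-1)%:E)) => y.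
  by rewrite muleA -EFinM mulVf ?mul1e // gt_eqF.
have Rf0 : 0 <= (f th0 x)%:E + Rcond N x.
  by rewrite adde_ge0 ?lee_fin ?f0 //; exact: Rcond_ge0.
rewrite Vmin_rec //; have := lmin_fin_num f th lam hk x.
case: (lmin x) => // l _; have e := mixture_eq_min l (psi01 x r0) Rf0.
split=> [/cfin_inj/fin_num_addeI/e -> //|/(_ c0)/e -> //].
Qed.

Lemma le_lower_boundS r : (0 < r)%N -> (r < N)%N ->
  lower_bound N psi r <= lower_bound N psi r.+1.
Proof.
move=> r0 rN; rewrite lower_bound_step // leeD2l // ge0_le_integral //.
- by move=> x _; exact: bellman_cost_ge0.
- exact: measurable_bellman_cost.
- exact: measurable_continuation_cost.
- by move=> x _; exact: bellman_cost_le.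
Qed.

Lemma stage_cost_ge0 n : (0 < n)%N -> 0 <= stage_cost psi n.
Proof.
by move=> n0; apply: integral_ge0 => x _; exact: stage_integrand_ge0.
Qed.

(** [lmin] is dominated by the cost of any fixed decision, a finite combination
    of probability densities. *)
Lemma stage_cost_lty n : (0 < n)%N -> stage_cost psi n < +oo.
Proof.
move=> n0; pose j := Ordinal hk.
have intf v : (mpow mu n).-integrable setT (fun x => (f v x)%:E).
  apply/integrableP; split; first by apply/measurable_EFinP; exact: mf.
  under eq_integral do rewrite gee0_abs ?lee_fin ?f0 //.
  by rewrite integral_density // ltry.
have intc : (mpow mu n).-integrable setT
    (fun x => (decision_cost f th lam j x)%:E).
  rewrite (_ : (fun _ => _) =
      fun x => \sum_(i < k | i != j) (lam i j)%:E * (f (th i) x)%:E).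
    by apply: integrable_sum => // i _; exact: (integrableZl _ _ (intf _)).
  by apply/funext => x; rewrite -sumEFin; apply: eq_bigr => i _; rewrite EFinM.
have intb := integrableD measurableT
  (integrableZl measurableT n%:R (intf th0)) intc.
apply: le_lt_trans (integrable_lty _ intb) => //; apply: ge0_le_integral => //.
- by move=> x _; exact: stage_integrand_ge0.
- exact: measurable_stage_integrand.
- exact: measurable_int intb.
- move=> x _; have /andP[p0 p1] := psi01 x n0.
  apply: (@le_trans _ _ ((n%:R * f th0 x)%:E + lmin x)).
    rewrite gee_pMl // ?lee_fin ?mulr_ile1 ?(cont_le1 psi_rule) //.
    by rewrite adde_ge0 ?lee_fin ?mulr_ge0 ?f0 ?lmin_ge0.
  by rewrite leeD // lmin_le.
Qed.

Lemma sum_stage_cost_fin_num r :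
  \sum_(1 <= n < r) stage_cost psi n \is a fin_num.
Proof.
apply/sum_fin_numP => n; rewrite mem_index_iota => /andP[n0 _] _.
by rewrite ge0_fin_numE ?stage_cost_lty ?stage_cost_ge0.
Qed.

Lemma LN_lty : LN N psi < +oo.
Proof. by rewrite /LN ltey_eq sum_stage_cost_fin_num. Qed.

(** Finiteness of the bound at [r] allows cancelling the common stage costs and
    reading equality of ordered integrals as equality almost everywhere. *)
Lemma lower_boundS_eq r : (0 < r)%N -> (r < N)%N ->
  lower_bound N psi r < +oo ->
  lower_bound N psi r.+1 = lower_bound N psi r <-> opt_cond N psi r.
Proof.
move=> r0 rN lb_lty.
have Hlty : \int[mpow mu r]_x bellman_cost x < +oo.
  move: lb_lty; rewrite /lower_bound -/(bellman_cost _) => lb_lty.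
  rewrite ltNge leye_eq; apply/negP => /eqP Hoo; move: lb_lty.
  by rewrite Hoo addey ?ltxx // gt_eqF // ltNye_eq sum_stage_cost_fin_num.
rewrite lower_bound_step //; apply: iff_trans.
  split=> [/(fin_num_addeI (sum_stage_cost_fin_num r)) e|e]; first exact: e.
  by rewrite [X in _ + X]e.
apply: iff_trans.
  apply: (ge0_integral_eq_ae (measurable_bellman_cost r0)) => // [|x|x|x].
  - exact: measurable_continuation_cost.
  - exact: bellman_cost_ge0.
  - exact: bellman_cost_fin_num.
  - exact: bellman_cost_le.
by split; apply: filterS => x; [move=> /(_ I)|move=> + _];
  rewrite bellman_cost_eq // !indic_pred.
Qed.

End rule.

(** At [N] stopping is certain and deciding is all that is left, so the last
    stage cost and the last integral of the bound coincide. *)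
Lemma LN_truncated psi N : (0 < N)%N -> truncated N psi ->
  LN N psi = lower_bound N psi N.
Proof.
move=> N0 [_ psiN]; rewrite /LN /lower_bound big_nat_recr //=; congr (_ + _).
by apply: eq_integral => x _; rewrite psiN mulr1 Vmin_last.
Qed.

(** Downward induction on [r], written as induction on the gap [g = N - r]: the
    bound at [r.+1] lies between the bound at [r] and [LN], so equality of the
    outer two is equality in both steps. *)
Lemma LN_lower_bound psi N r : truncated N psi -> (0 < r)%N -> (r <= N)%N ->
  lower_bound N psi r <= LN N psi /\
  (LN N psi = lower_bound N psi r <->
    forall m, (r <= m)%N -> (m < N)%N -> opt_cond N psi m).
Proof.
move=> psiN r0 rN; have [psi_rule _] := psiN.
have [g Ng] : exists g, N = (r + g)%N by exists (N - r)%N; rewrite subnKC.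
elim: g r r0 rN Ng => [|g IH] r r0 rN Ng.
  have -> : r = N by rewrite Ng addn0.
  rewrite LN_truncated //; last by rewrite Ng addn0.
  by split=> //; split=> // _ m Nm; rewrite ltnNge Nm.
have {}rN : (r < N)%N by rewrite Ng -addSnnS leq_addr.
have [leN eqN] := IH r.+1 isT rN (etrans Ng (esym (addSnnS r g))).
have leS := le_lower_boundS psi_rule r0 rN; split; first exact: le_trans leN.
have lb_lty : lower_bound N psi r < +oo.
  exact: le_lt_trans (le_trans leS leN) (LN_lty N psi_rule).
have eqS := lower_boundS_eq psi_rule r0 rN lb_lty.
split=> [e m rm mN|opt].
  have eS : lower_bound N psi r.+1 = lower_bound N psi r.
    by apply/le_anti; rewrite leS andbT -e.
  move: rm; rewrite leq_eqVlt => /predU1P[<-|rm]; first exact/eqS.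
  by apply: eqN.1 mN => //; rewrite e.
rewrite eqN.2 => [|m rm mN]; first by apply/eqS; exact: opt.
by apply: opt => //; exact: ltnW.
Qed.

End backward_induction.

(** * The minimal risk of a truncated rule *)

(** With [a j] the probability of success in the [j]-th independent trial, both
    sides are the probability of a success, split on the left by its time. *)
Lemma sum_first_success (R : comPzRingType) k (a : 'I_k -> R) :
  \sum_(j < k) a j * \prod_(i < k | (i < j)%N) (1 - a i) =
  1 - \prod_(i < k) (1 - a i).
Proof.
elim: k a => [|k IH] a; first by rewrite !big_ord0 subrr.
pose b i := a (widen_ord (leqnSn k) i).
rewrite big_ord_recr [in RHS]big_ord_recr /=.
have -> : \prod_(i < k.+1 | (i < k)%N) (1 - a i) = \prod_(i < k) (1 - b i).
  rewrite big_mkcond big_ord_recr /= ltnn mulr1; apply: eq_bigr => i _.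
  by rewrite ltn_ord.
have -> : \sum_(j < k) b j * \prod_(i < k.+1 | (i < j)%N) (1 - a i) =
    \sum_(j < k) b j * \prod_(i < k | (i < j)%N) (1 - b i).
  apply: eq_bigr => j _; congr (_ * _); rewrite big_mkcond big_ord_recr /=.
  by rewrite ltnNge (ltnW (ltn_ord j)) mulr1 -big_mkcond.
by rewrite IH /b; ring.
Qed.

Lemma nneseries_finite (R : realType) (u : nat -> \bar R) N :
  (forall n, (0 < n)%N -> (0 <= u n)%E) ->
  (forall n, (N < n)%N -> u n = 0%E) ->
  (\sum_(1 <= n <oo) u n = \sum_(1 <= n < N.+1) u n)%E.
Proof.
move=> u0 uN; rewrite (nneseries_split 1 N) // add1n.
by rewrite [X in (_ + X)%E]eseries0 ?adde0 // => n Nn _; exact: uN.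
Qed.

Section minimal_risk.
Context d d' (T : measurableType d) (Omega : measurableType d') (R : realType).
Context (mu : {sigma_finite_measure set T -> \bar R}).
Context (Theta : Type) (P : Theta -> probability Omega R).
Context (X : nat -> {mfun Omega >-> T}).
Context (f : Theta -> forall n, n.-tuple T -> R).
Hypothesis hf : forall v, is_density_family mu (P v) X (f v).
Context (k : nat) (th : 'I_k -> Theta) (th0 : Theta) (lam : 'I_k -> 'I_k -> R).
Hypothesis hk : (0 < k)%N.
Hypothesis hlam : forall i j, i != j -> 0 <= lam i j.
Context (N : nat) (psi : forall n, n.-tuple T -> R).
Hypothesis N0 : (0 < N)%N.
Hypothesis psiN : truncated N psi.
Local Open Scope ereal_scope.
Local Notation lmin := (lmin f th lam).
Local Notation decision_cost := (decision_cost f th lam).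

Let mf := measurable_density hf.
Let f0 := density_ge0 hf.
Let psi_rule : stopping_rule psi := psiN.1.

Let mpsi n : (0 < n)%N -> measurable_fun setT (@psi n).
Proof. by move=> n0; have [] := psi_rule n0. Qed.

Let psi0 n (x : n.-tuple T) : (0 < n)%N -> (0 <= psi x)%R.
Proof. by move=> n0; have [_ /(_ x)/andP[]] := psi_rule n0. Qed.

Let mcont n := measurable_cont psi_rule (n := n).
Let cont0 := cont_ge0 psi_rule.

Lemma measurable_stop n : (0 < n)%N ->
  measurable_fun setT (fun x : n.-tuple T => cont psi x * psi x)%R.
Proof. by move=> n0; apply: measurable_funM; [exact: mcont|exact: mpsi]. Qed.

Lemma stop_ge0 n (x : n.-tuple T) : (0 < n)%N -> (0 <= cont psi x * psi x)%R.
Proof. by move=> n0; rewrite mulr_ge0 // psi0. Qed.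

Lemma Exp_density v n (F : n.-tuple T -> R) : (0 < n)%N ->
  measurable_fun setT F -> (forall x, 0 <= F x)%R ->
  Exp (P v) X F = \int[mpow mu n]_x (F x * f v x)%:E.
Proof.
move=> n0 mF F0; rewrite /Exp unlock.
rewrite (integral_first_vars (hf v) (g := EFin \o F)) //.
by apply/measurable_EFinP.
Qed.

Lemma Exp_ge0 v n (F : n.-tuple T -> R) :
  (forall x, 0 <= F x)%R -> 0 <= Exp (P v) X F.
Proof.
by move=> F0; rewrite /Exp unlock; apply: integral_ge0 => w _; rewrite lee_fin.
Qed.

Lemma Exp_stopped_after v n (F : n.-tuple T -> R) : (N < n)%N ->
  Exp (P v) X (fun x => cont psi x * F x)%R = 0.
Proof.
move=> Nn; rewrite /Exp unlock integral0_eq // => w _.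
by rewrite (cont_truncated _ N0 psiN Nn) mul0r.
Qed.

(** The sum telescopes, as [cont * psi] at [n] is the decrease of [cont] from
    [n] to [n.+1], and [cont] falls from 1 to 0. *)
Lemma sum_stop w :
  (\sum_(1 <= n < N.+1)
     cont psi (first_vars X n w) * psi (first_vars X n w) = 1)%R.
Proof.
suff H m : (\sum_(1 <= n < m.+1)
    cont psi (first_vars X n w) * psi (first_vars X n w) =
    1 - cont psi (first_vars X m.+1 w))%R.
  by rewrite H (cont_truncated _ N0 psiN (ltnSn N)) subr0.
elim: m => [|m IH]; first by rewrite big_nil cont1 subrr.
by rewrite big_nat_recr //= IH [in RHS]first_varsS contS //; ring.
Qed.

Lemma stop_prob_fin_truncated v : stop_prob_fin P X v psi = 1.
Proof.
rewrite /stop_prob_fin (nneseries_finite (N := N)); last 2 first.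
- by move=> n n0; apply: Exp_ge0 => x; exact: stop_ge0.
- by move=> n Nn; exact: Exp_stopped_after.
(* The interchange lemma asks for measurable nonnegative summands at every index,
   and psi_0 is arbitrary: the value 0 replaces it. *)
pose g n w := if (0 < n)%N
  then (cont psi (first_vars X n w) * psi (first_vars X n w))%:E else 0.
transitivity (\sum_(1 <= n < N.+1) \int[P v]_w g n w).
  apply: eq_big_nat => n /andP[n0 _].
  by rewrite /stop_prob /Exp unlock /g n0.
rewrite -ge0_integral_sum //.
- transitivity (\int[P v]_w cst 1 w).
    apply: eq_integral => w _.
    rewrite -(sum_stop w) -sumEFin; apply: eq_big_nat => n /andP[n0 _].
    by rewrite /g n0.
  by rewrite integral_cst // mul1e; exact: probability_setT.
- move=> n; rewrite /g; case: (boolP (0 < n)%N) => // n0.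
  apply/measurable_EFinP.
  apply: (measurableT_comp (measurable_stop n0)); exact: measurable_first_vars.
- move=> n w _; rewrite /g; case: (boolP (0 < n)%N) => // n0.
  by rewrite lee_fin stop_ge0.
Qed.

(** The contribution of stage [n] to the risk, in the form that compares with
    [stage_cost] pointwise: the averaged decision cost replaces [lmin]. *)
Definition stage_risk (phi : forall n, n.-tuple T -> 'I_k -> R) n : \bar R :=
  \int[mpow mu n]_x (cont psi x * psi x *
    (n%:R * f th0 x + \sum_(j < k) phi n x j * decision_cost j x))%:E.

(** All series stop at [N] and all terms are integrals of nonnegative functions
    against the densities, so the sums over [n] and over pairs of hypotheses can
    be interchanged with each other and with the integral. *)
Lemma Lrisk_truncated phi : decision_rule phi ->
  Lrisk P X th th0 lam psi phi = \sum_(1 <= n < N.+1) stage_risk phi n.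
Proof.
move=> phi_rule.
have phi0 n (x : n.-tuple T) j : (0 < n)%N -> (0 <= phi n x j)%R.
  by move=> n0; have [_] := phi_rule n n0.
have mphi n j : (0 < n)%N -> measurable_fun setT (fun x => phi n x j).
  by move=> n0; have [+ _ _] := phi_rule n n0; exact.
rewrite /Lrisk /mean_size stop_prob_fin_truncated eqxx.
rewrite (nneseries_finite (N := N)); last 2 first.
- by move=> n n0; rewrite mule_ge0 //; apply: Exp_ge0 => x; exact: stop_ge0.
- by move=> n Nn; rewrite /stop_prob Exp_stopped_after // mule0.
(* Diagonal losses may be negative; replacing them by zero makes all terms of
   the double sum nonnegative. *)
pose l i j : R := if i != j then lam i j else 0%R.
have l0 i j : (0 <= l i j)%R by rewrite /l; case: ifP => // /hlam.
have lE j n (x : n.-tuple T) :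
    decision_cost j x = (\sum_(i < k) l i j * f (th i) x)%R.
  rewrite /decision_cost big_mkcond; apply: eq_bigr => i _.
  by rewrite /l; case: ifP; rewrite ?mul0r.
pose A n (p : 'I_k * 'I_k) :=
  Exp (P (th p.1)) X (fun x : n.-tuple T => cont psi x * psi x * phi n x p.2)%R.
have A0 n p : (0 < n)%N -> 0 <= A n p.
  by move=> n0; apply: Exp_ge0 => x; rewrite mulr_ge0 ?stop_ge0 ?phi0.
have alphaE i j : alpha P X th psi phi i j = \sum_(1 <= n < N.+1) A n (i, j).
  rewrite /alpha (nneseries_finite (N := N)) // => n n0.
    exact: (A0 n (i, j)).
  under eq_fun do rewrite -mulrA; exact: Exp_stopped_after.
transitivity (\sum_(1 <= n < N.+1) n%:R%:E * stop_prob P X th0 psi n +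
    \sum_(1 <= n < N.+1) \sum_p (l p.1 p.2)%:E * A n p).
  congr (_ + _); rewrite exchange_big /= -(pair_big xpredT xpredT
    (fun i j => \sum_(1 <= n < N.+1) (l i j)%:E * A n (i, j))) /=.
  apply: eq_bigr => i _; rewrite big_mkcond; apply: eq_bigr => j _.
  rewrite /l alphaE; case: ifP => ij; last first.
    by rewrite big1 // => n _; rewrite mul0e.
  rewrite [in LHS]big_nat_cond [in RHS]big_nat_cond ge0_sume_distrr // => n.
  by move=> /andP[/andP[n0 _] _]; exact: A0.
rewrite -big_split /=; apply: eq_big_nat => n /andP[n0 _].
have ms := measurable_stop n0; have s0 (x : n.-tuple T) := stop_ge0 x n0.
have msf v : measurable_fun setT
    (fun x : n.-tuple T => cont psi x * psi x * f v x)%R.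
  by apply: measurable_funM => //; exact: mf.
have msphi j : measurable_fun setT
    (fun x : n.-tuple T => cont psi x * psi x * phi n x j)%R.
  by apply: measurable_funM => //; exact: mphi.
have msphif i j : measurable_fun setT
    (fun x : n.-tuple T => cont psi x * psi x * phi n x j * f (th i) x)%R.
  by apply: measurable_funM => //; exact: mf.
have sphi0 j (x : n.-tuple T) : (0 <= cont psi x * psi x * phi n x j)%R.
  by rewrite mulr_ge0 // phi0.
rewrite /stop_prob Exp_density // -ge0_integralZl_EFin //; last 2 first.
- by move=> x _; rewrite lee_fin mulr_ge0 // f0.
- by apply/measurable_EFinP.
transitivity (\int[mpow mu n]_x (n%:R%:E * (cont psi x * psi x * f th0 x)%:E) +
  \int[mpow mu n]_x \sum_p
    ((l p.1 p.2)%:E * (cont psi x * psi x * phi n x p.2 * f (th p.1) x)%:E)).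
  congr (_ + _); rewrite ge0_integral_sum //; last 2 first.
  - by move=> p; apply: measurable_funeM; apply/measurable_EFinP.
  - by move=> p x _; rewrite mule_ge0 ?lee_fin // mulr_ge0 // f0.
  apply: eq_bigr => -[i j] _ /=.
  rewrite /A Exp_density // ge0_integralZl_EFin //.
  - by move=> x _; rewrite lee_fin mulr_ge0 // f0.
  - by apply/measurable_EFinP.
rewrite -ge0_integralD //; last 4 first.
- by move=> x _; rewrite mule_ge0 // lee_fin mulr_ge0 // f0.
- by apply: measurable_funeM; apply/measurable_EFinP.
- move=> x _; apply: sume_ge0 => p _.
  by rewrite mule_ge0 ?lee_fin // mulr_ge0 // f0.
- by apply: emeasurable_sum => p; apply: measurable_funeM; apply/measurable_EFinP.
apply: eq_integral => x _; rewrite -EFinM.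
under eq_bigr do rewrite -EFinM.
rewrite sumEFin -EFinD; congr EFin; rewrite mulrDr mulrCA; congr (_ + _)%R.
rewrite mulr_sumr -(pair_big xpredT xpredT (fun i j =>
  l i j * (cont psi x * psi x * phi n x j * f (th i) x)))%R /= exchange_big /=.
apply: eq_bigr => j _; rewrite lE !mulr_sumr; apply: eq_bigr => i _; ring.
Qed.

Lemma measurable_risk_integrand phi n : decision_rule phi -> (0 < n)%N ->
  measurable_fun setT (fun x => (cont psi x * psi x *
    (n%:R * f th0 x + \sum_(j < k) phi n x j * decision_cost j x))%:E).
Proof.
move=> phi_rule n0; have [mphi _ _] := phi_rule n n0.
apply/measurable_EFinP/measurable_funM; first exact: measurable_stop.
apply: measurable_funD; first by apply: measurable_funM => //; exact: mf.
apply: measurable_sum => j; apply: measurable_funM => //.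
exact: measurable_decision_cost.
Qed.

Lemma lmin_le_mixture phi n (x : n.-tuple T) : (0 < n)%N -> decision_rule phi ->
  lmin x <= (\sum_(j < k) phi n x j * decision_cost j x)%:E.
Proof.
move=> n0 phi_rule; have [_ phi0 phi1] := phi_rule n n0.
have [j0 lE] := lmin_attained f th lam hk x.
rewrite lE lee_fin -[leLHS]mul1r -(phi1 x) mulr_suml; apply: ler_sum => j _.
by rewrite ler_wpM2l // -lee_fin -lE lmin_le.
Qed.

Lemma LN_le_Lrisk phi : decision_rule phi ->
  LN mu f th th0 lam N psi <= Lrisk P X th th0 lam psi phi.
Proof.
move=> phi_rule; rewrite Lrisk_truncated // /LN big_nat_cond [leRHS]big_nat_cond.
apply: lee_sum => n /andP[/andP[n0 _] _]; apply: ge0_le_integral => //.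
- move=> x _; exact: (stage_integrand_ge0 hf).
- exact: (measurable_stage_integrand hf).
- exact: measurable_risk_integrand.
- move=> x _; rewrite [leRHS]EFinM lee_wpmul2l ?lee_fin ?stop_ge0 // EFinD leeD2l //.
  exact: lmin_le_mixture.
Qed.

Definition minimizes n (x : n.-tuple T) (j : 'I_k) : R :=
  \1_[set y : n.-tuple T | (decision_cost j y)%:E = lmin y] x.

(** Choose the first [j] of minimal cost.  Taking the first one, by a product
    of indicators, keeps the rule measurable and makes it sum to one. *)
Definition minimizer_rule n (x : n.-tuple T) (j : 'I_k) : R :=
  (minimizes x j * \prod_(i < k | (i < j)%N) (1 - minimizes x i))%R.

Lemma measurable_minimizes n j : (0 < n)%N ->
  measurable_fun setT (fun x : n.-tuple T => minimizes x j).
Proof.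
move=> n0; apply: measurable_indic; rewrite -[X in measurable X]setTI.
apply: measurable_eqe => //; last exact: measurable_lmin.
by apply/measurable_EFinP; exact: measurable_decision_cost.
Qed.

Lemma decision_rule_minimizer : decision_rule minimizer_rule.
Proof.
move=> n n0; split=> [j|x j|x].
- apply: measurable_funM; first exact: measurable_minimizes.
  rewrite (_ : (fun _ => _) = fun x : n.-tuple T =>
    (\prod_(i < k) if (i < j)%N then 1 - minimizes x i else 1)%R); last first.
    by apply/funext => x; rewrite big_mkcond.
  apply: measurable_prod => i _; case: (i < j)%N => //.
  by apply: measurable_funB => //; exact: measurable_minimizes.
- rewrite mulr_ge0 ?prodr_ge0 // => i _.
  by rewrite subr_ge0 /minimizes indicE lern1 leq_b1.
- rewrite sum_first_success; have [j lE] := lmin_attained f th lam hk x.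
  by rewrite (bigD1 j) //= {1}/minimizes indicE mem_set // subrr mul0r subr0.
Qed.

Lemma Lrisk_minimizer :
  Lrisk P X th th0 lam psi minimizer_rule = LN mu f th th0 lam N psi.
Proof.
rewrite Lrisk_truncated; last exact: decision_rule_minimizer.
apply: eq_big_nat => n /andP[n0 _]; apply: eq_integral => x _.
rewrite EFinM EFinD; congr (_ * (_ + _)).
have lfin := lmin_fin_num f th lam hk x.
rewrite -[RHS]fineK //; congr EFin; rewrite -[RHS]mul1r.
have [_ _ /(_ x) <-] := decision_rule_minimizer n0.
rewrite mulr_suml; apply: eq_bigr => j _.
rewrite /minimizer_rule /minimizes indicE.
case: (boolP (x \in _)); last by rewrite !mul0r.
by rewrite in_setE /= => <-.
Qed.

Lemma Lopt_truncated : Lopt P X th th0 lam psi = LN mu f th th0 lam N psi.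
Proof.
apply/le_anti/andP; split.
  rewrite -Lrisk_minimizer; apply: ereal_inf_lbound.
  by exists minimizer_rule => //; exact: decision_rule_minimizer.
by apply: le_ereal_inf_tmp => _ [phi phi_rule <-]; exact: LN_le_Lrisk.
Qed.

End minimal_risk.

(** * The optimal truncated rule *)

Section optimal_rule.
Context d d' (T : measurableType d) (Omega : measurableType d') (R : realType).
Context (mu : {sigma_finite_measure set T -> \bar R}).
Context (Theta : Type) (P : Theta -> probability Omega R).
Context (X : nat -> {mfun Omega >-> T}).
Context (f : Theta -> forall n, n.-tuple T -> R).
Hypothesis hf : forall v, is_density_family mu (P v) X (f v).
Context (k : nat) (th : 'I_k -> Theta) (th0 : Theta) (lam : 'I_k -> 'I_k -> R).
Hypothesis hk : (0 < k)%N.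
Hypothesis hlam : forall i j, i != j -> 0 <= lam i j.
Context (N : nat).
Local Open Scope ereal_scope.
Local Notation lmin := (lmin f th lam).
Local Notation Rcond := (Rcond mu f th th0 lam).
Local Notation Vmin := (Vmin mu f th th0 lam).

Let mf := measurable_density hf.
Let f0 := density_ge0 hf.

(** Bellman's rule, with ties resolved by stopping.  It stops from [N] on, which
    makes it truncated. *)
Definition optimal_rule n (x : n.-tuple T) : R :=
  if (n < N)%N
  then \1_[set y : n.-tuple T | lmin y <= (f th0 y)%:E + Rcond N y] x else 1%R.

Lemma truncated_optimal_rule : truncated N optimal_rule.
Proof.
split=> [n n0|x]; last by rewrite /optimal_rule ltnn.
split=> [|x]; rewrite /optimal_rule; case: (n < N)%N; rewrite ?ler01 ?lexx //.
  apply: measurable_indic; rewrite -[X in measurable X]setTI.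
  apply: measurable_lee => //; first exact: (measurable_lmin th lam mf n0).
  apply: emeasurable_funD.
    by apply/measurable_EFinP; exact: mf.
  exact: (measurable_Rcond mu th th0 mf f0 hk hlam N).
by rewrite indicE ler0n lern1 leq_b1.
Qed.

Lemma opt_cond_optimal_rule m : (m < N)%N ->
  opt_cond mu f th th0 lam N optimal_rule m.
Proof.
move=> mN; apply: aeW => x _; rewrite /optimal_rule mN !indic_pred lexx andbT.
by rewrite ler_nat; case: ltgtP.
Qed.

(** Nothing can be stopped before the first observation, so [psi] disappears;
    the constant is the total mass of the density. *)
Lemma lower_bound1 psi : (0 < N)%N ->
  lower_bound mu f th th0 lam N psi 1 = 1 + \int[mu]_t Vmin N [tuple t].
Proof.
move=> N0.
have mV : measurable_fun setT (@Vmin N 1).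
  exact: (measurable_Vmin mu th th0 mf f0 hk hlam).
have V0 (x : 1.-tuple T) : 0 <= Vmin N x.
  exact: (Vmin_ge0 mu th th0 f0 hk hlam).
rewrite /lower_bound big_geq // add0e -(integral_mpow1 mu mV V0).
rewrite -(integral_density hf th0 (ltn0Sn 0)) -ge0_integralD //.
- by apply: eq_integral => x _; rewrite cont1 mul1e mul1r.
- by move=> x _; rewrite lee_fin f0.
- by apply/measurable_EFinP; exact: mf.
Qed.

End optimal_rule.

Theorem theorem4 (R : realType) (d d' : measure_display)
  (T : measurableType d) (Omega : measurableType d')
  (mu : {sigma_finite_measure set T -> \bar R})
  (Theta : Type) (P : Theta -> probability Omega R)
  (X : nat -> {mfun Omega >-> T})
  (f : Theta -> forall n, n.-tuple T -> R)
  (hf : forall v, is_density_family mu (P v) X (f v))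
  (k : nat) (hk : (2 <= k)%N)
  (th : 'I_k -> Theta) (th0 : Theta)
  (lam : 'I_k -> 'I_k -> R) (hlam : forall i j, i != j -> 0 <= lam i j)
  (N : nat) (hN : (1 <= N)%N) :
  [/\
    forall psi : (forall n, n.-tuple T -> R), truncated N psi ->
      forall r : nat, (1 <= r)%N -> (r <= N - 1)%N ->
      [/\ (LN mu f th th0 lam N psi
             >= lower_bound mu f th th0 lam N psi r.+1)%E,
          (lower_bound mu f th th0 lam N psi r.+1
             >= lower_bound mu f th th0 lam N psi r)%E &
          LN mu f th th0 lam N psi = lower_bound mu f th th0 lam N psi r <->
          (forall m : nat, (r <= m)%N -> (m <= N - 1)%N ->
             opt_cond mu f th th0 lam N psi m)],
    forall psi : (forall n, n.-tuple T -> R), truncated N psi ->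
      ((forall psi' : (forall n, n.-tuple T -> R), truncated N psi' ->
          (Lopt P X th th0 lam psi <= Lopt P X th th0 lam psi')%E) <->
       (forall m : nat, (1 <= m)%N -> (m <= N - 1)%N ->
          opt_cond mu f th th0 lam N psi m)),
    (exists2 psi : (forall n, n.-tuple T -> R), truncated N psi &
       Lopt P X th th0 lam psi
         = (1 + \int[mu]_x Vmin mu f th th0 lam N [tuple x])%E),
    (forall psi : (forall n, n.-tuple T -> R), truncated N psi ->
       (1 + \int[mu]_x Vmin mu f th th0 lam N [tuple x]
         <= Lopt P X th th0 lam psi)%E) &
    (1 + \int[mu]_x Vmin mu f th th0 lam N [tuple x]
       = 1 + Rcond0 mu f th th0 lam N)%E ].
Proof.
have k0 : (0 < k)%N by exact: ltn_trans hk.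
have dec psi (psiN : truncated N psi) r :=
  LN_lower_bound hf th th0 k0 hlam psiN (r := r).
have lb psi : truncated N psi ->
    (1 + \int[mu]_x Vmin mu f th th0 lam N [tuple x] <= Lopt P X th th0 lam psi)%E.
  move=> psiN; rewrite (Lopt_truncated hf th th0 k0 hlam hN psiN).
  rewrite -(lower_bound1 hf th th0 k0 hlam psi hN).
  exact: (dec psi psiN 1%N isT hN).1.
have eqlb psi (psiN : truncated N psi) :
    Lopt P X th th0 lam psi = (1 + \int[mu]_x Vmin mu f th th0 lam N [tuple x])%E
    <-> forall m, (1 <= m)%N -> (m <= N - 1)%N -> opt_cond mu f th th0 lam N psi m.
  rewrite (Lopt_truncated hf th th0 k0 hlam hN psiN).
  rewrite -(lower_bound1 hf th th0 k0 hlam psi hN).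
  rewrite subn1; split=> [e m m0 mN|opt].
    by apply: (dec psi psiN 1%N isT hN).2.1 => //; rewrite -(prednK hN).
  apply: (dec psi psiN 1%N isT hN).2.2 => // m m0 mN.
  by apply: opt => //; rewrite -ltnS prednK.
have psiN := truncated_optimal_rule hf th th0 k0 hlam N.
have psi_opt : Lopt P X th th0 lam (optimal_rule mu f th th0 lam N) =
    (1 + \int[mu]_x Vmin mu f th th0 lam N [tuple x])%E.
  apply/(eqlb _ psiN) => m _ mN; apply: opt_cond_optimal_rule.
  by rewrite -(prednK hN) ltnS -subn1.
split=> //.
- move=> psi psiN' r r0 rN.
  have {}rN : (r < N)%N by rewrite -(prednK hN) ltnS -subn1.
  split.
  + exact: (dec psi psiN' r.+1 isT rN).1.
  + exact: (le_lower_boundS hf th th0 k0 hlam psiN'.1).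
  + apply: iff_trans (dec psi psiN' r r0 (ltnW rN)).2 _.
    by split=> opt m rm mN; apply: opt => //; move: mN;
      rewrite -{1 2}(prednK hN) ltnS subn1.
- move=> psi psiN'; apply: iff_trans (eqlb psi psiN'); split=> [opt|-> //].
  by apply/le_anti; rewrite lb // andbT -psi_opt opt.
- by exists (optimal_rule mu f th th0 lam N).
Qed.
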